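(* Let $L,D>0$, $N\ge 0$, and let $(x_i,f_i,g_i)_{i=0}^N$ with $x_i,g_i\in\mathbb{R}^d$, $f_i\in\mathbb{R}$ be first-order information consistent with some $L$-smooth convex function on $\mathbb{R}^d$ possessing a minimizer at distance at most $D$ from $x_0$. Let $$r_\star=\max_{x_\star\in\mathbb{R}^d,\ f_\star\in\mathbb{R}}\Big\{ f_N-f_\star \ :\ D^2-\|x_0-x_\star\|^2\ge 0,\ \ f_\star-f_i-\langle g_i,x_\star-x_i\rangle-\tfrac{1}{2L}\|g_i\|^2\ge 0,\ \ f_i-f_\star-\tfrac{1}{2L}\|g_i\|^2\ge 0\ \ \forall i=0,\dots,N\Big\}.$$ Then there exist nonnegative weights $a_0,\dots,a_N$ with $\sum_{i=0}^N a_i=1$ such that, setting $$\alpha(x)=\sum_{i=0}^N a_i\Big(f_i+\tfrac{1}{2L}\|g_i\|^2+\langle g_i,x-x_i\rangle\Big),$$ the following holds for every $L$-smooth convex function $f:\mathbb{R}^d\to\mathbb{R}$ consistent with $(x_i,f_i,g_i)_{i=0}^N$ and every minimizer $x_\star$ of $f$ with $\|x_0-x_\star\|\le D$, writing $f_\star=f(x_\star)$: $\alpha\in A_f^\star$ and $$f_N-f_\star\ \le\ f_N-f_\star+\sigma\|z_{N+1}-x_\star\|^2\ \le\ f_N-\alpha(x_\star)+\sigma\|z_{N+1}-x_\star\|^2\ \le\ f_N-\min_{\|x-x_0\|\le D}\alpha(x)\ \le\ r_\star,$$ where, if $\nabla\alpha\ne 0$, $\sigma=\frac{\|\nabla\alpha\|}{2D}$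 and $z_{N+1}=x_0-\frac{1}{2\sigma}\nabla\alpha$, and otherwise $\sigma=0$ and $z_{N+1}\in\mathbb{R}^d$ is arbitrary.
   Context: $\|\cdot\|$ and $\langle\cdot,\cdot\rangle$ are the Euclidean norm and inner product. A function is $L$-smooth if it is differentiable with $L$-Lipschitz gradient. An $L$-smooth convex function $f:\mathbb{R}^d\to\mathbb{R}$ is consistent with first-order information $(x_i,f_i,g_i)_{i=0}^N$ if $f(x_i)=f_i$ and $\nabla f(x_i)=g_i$ for all $i=0,\dots,N$. Given $f$ and its minimizer $x_\star$, $A_f^\star$ is the set of affine functions $\alpha(x)=\langle a,x\rangle+b$ on $\mathbb{R}^d$ with $\alpha(x_\star)\le f(x_\star)$ (''affine minorants at the minimizer''). For affine $\alpha$, $\nabla\alpha$ denotes its constant gradient. *)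

(* Defs.v *)
From mathcomp Require Import all_boot all_order all_algebra.
From mathcomp Require Import classical_sets reals topology normedtype derive.
From mathcomp Require Import convex.

Set Implicit Arguments.
Unset Strict Implicit.
Unset Printing Implicit Defensive.

Import Order.TTheory GRing.Theory Num.Theory.
Import numFieldNormedType.Exports.

Local Open Scope classical_set_scope.
Local Open Scope ring_scope.

(* The canonical norm `|v| on 'rV[R]_d is the sup norm, hence a separate
   Euclidean norm.  Differentiability does not depend on this choice. *)
Definition edot (R : realType) (d : nat) (u v : 'rV[R]_d) : R :=
  \sum_(j < d) u 0 j * v 0 j.

Definition enorm (R : realType) (d : nat) (v : 'rV[R]_d) : R :=
  Num.sqrt (edot v v).

(* Coordinates of the differential in the standard basis; only meaningful
   where f is differentiable. *)
Definition gradient (R : realType) (d : nat) (f : 'rV[R]_d -> R)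
    (x : 'rV[R]_d) : 'rV[R]_d :=
  \row_(j < d) 'd f x (delta_mx 0 j).

Definition smooth (R : realType) (d : nat) (L : R) (f : 'rV[R]_d -> R) : Prop :=
  (forall x, differentiable f x) /\
  (forall x y, enorm (gradient f x - gradient f y) <= L * enorm (x - y)).

Definition smooth_convex (R : realType) (d : nat) (L : R)
    (f : 'rV[R]_d -> R) : Prop :=
  smooth L f /\ convex_function [set: 'rV[R]_d] f.

Definition consistent (R : realType) (d N : nat) (x : 'I_N.+1 -> 'rV[R]_d)
    (fv : 'I_N.+1 -> R) (g : 'I_N.+1 -> 'rV[R]_d) (f : 'rV[R]_d -> R) : Prop :=
  forall i, f (x i) = fv i /\ gradient f (x i) = g i.

Definition minimizer (R : realType) (d : nat) (f : 'rV[R]_d -> R)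
    (xs : 'rV[R]_d) : Prop :=
  forall y, f xs <= f y.

Definition is_maximum (R : realType) (S : set R) (m : R) : Prop :=
  S m /\ ubound S m.

Definition is_minimum (R : realType) (S : set R) (m : R) : Prop :=
  S m /\ lbound S m.

Definition eball (R : realType) (d : nat) (c : 'rV[R]_d) (D : R) :
    set 'rV[R]_d :=
  [set x | enorm (x - c) <= D].

Definition affine (R : realType) (d : nat) (alpha : 'rV[R]_d -> R) : Prop :=
  exists (a : 'rV[R]_d) (b : R), forall x, alpha x = edot a x + b.

Definition affine_minorants (R : realType) (d : nat) (f : 'rV[R]_d -> R)
    (xs : 'rV[R]_d) : set ('rV[R]_d -> R) :=
  [set alpha | affine alpha /\ alpha xs <= f xs].

Definition feasible (R : realType) (d N : nat) (L D : R)
    (x : 'I_N.+1 -> 'rV[R]_d) (fv : 'I_N.+1 -> R) (g : 'I_N.+1 -> 'rV[R]_d)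
    (xs : 'rV[R]_d) (fs : R) : Prop :=
  0 <= D ^+ 2 - enorm (x ord0 - xs) ^+ 2 /\
  forall i,
    0 <= fs - fv i - edot (g i) (xs - x i) - 1 / (2 * L) * enorm (g i) ^+ 2 /\
    0 <= fv i - fs - 1 / (2 * L) * enorm (g i) ^+ 2.

Definition certificate_gaps (R : realType) (d N : nat) (L D : R)
    (x : 'I_N.+1 -> 'rV[R]_d) (fv : 'I_N.+1 -> R)
    (g : 'I_N.+1 -> 'rV[R]_d) : set R :=
  [set r | exists xs fs, feasible L D x fv g xs fs /\ r = fv ord_max - fs].

Definition aggregate (R : realType) (d N : nat) (L : R)
    (x : 'I_N.+1 -> 'rV[R]_d) (fv : 'I_N.+1 -> R) (g : 'I_N.+1 -> 'rV[R]_d)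
    (a : 'I_N.+1 -> R) (y : 'rV[R]_d) : R :=
  \sum_(i < N.+1)
    a i * (fv i + 1 / (2 * L) * enorm (g i) ^+ 2 + edot (g i) (y - x i)).

(* Main.v *)
(* Let l_i(y) = f_i + |g_i|^2 / (2 L) + <g_i, y - x_i>.  Smoothness and
   convexity give l_i(x_star) <= f_star, so every convex combination of the
   l_i is an affine minorant at the minimizer.  A minimax argument over the simplex and
   the ball yields weights a and a point y of the ball with
     max_i l_i(y) <= m, the minimum over the ball of sum_i a_i l_i,
   so m is the least f_star of the certificate problem: (y, m) satisfies the
   constraints f_i - f_star >= |g_i|^2 / (2 L) because m lies below the minimum
   of the given consistent function.  The sigma term is absorbed by completing
   the square. *)
From HB Require Import structures.
Require Import Defs.
From mathcomp Require Import all_boot all_order all_algebra.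
From mathcomp Require Import classical_sets reals topology normedtype derive.
From mathcomp Require Import convex.
From mathcomp Require Import boolp functions interval_inference.
From mathcomp Require Import function_spaces realfun ring lra.

Set Implicit Arguments.
Unset Strict Implicit.
Unset Printing Implicit Defensive.

Import Order.TTheory GRing.Theory Num.Theory.
Import numFieldNormedType.Exports.

Local Open Scope classical_set_scope.
Local Open Scope ring_scope.

(** * Euclidean inner product and norm *)

Section Euclidean.
Context {R : realType} {d : nat}.
Implicit Types (u v w : 'rV[R]_d) (k : R).

Lemma edotC u v : edot u v = edot v u.
Proof. by apply: eq_bigr => j _; rewrite mulrC. Qed.

Lemma edotDr u v w : edot u (v + w) = edot u v + edot u w.
Proof. by rewrite -big_split; apply: eq_bigr => j _; rewrite mxE mulrDr. Qed.

Lemma edotZr k u v : edot u (k *: v) = k * edot u v.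
Proof. by rewrite mulr_sumr; apply: eq_bigr => j _; rewrite mxE mulrCA. Qed.

Lemma edotNr u v : edot u (- v) = - edot u v.
Proof. by rewrite -scaleN1r edotZr mulN1r. Qed.

Lemma edotBr u v w : edot u (v - w) = edot u v - edot u w.
Proof. by rewrite edotDr edotNr. Qed.

Lemma edotDl u v w : edot (u + v) w = edot u w + edot v w.
Proof. by rewrite !(edotC _ w) edotDr. Qed.

Lemma edotZl k u v : edot (k *: u) v = k * edot u v.
Proof. by rewrite !(edotC _ v) edotZr. Qed.

Lemma edotNl u v : edot (- u) v = - edot u v.
Proof. by rewrite !(edotC _ v) edotNr. Qed.

Lemma edotBl u v w : edot (u - v) w = edot u w - edot v w.
Proof. by rewrite edotDl edotNl. Qed.

Lemma edot0l u : edot 0 u = 0.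
Proof. by rewrite -(scale0r 0) edotZl mul0r. Qed.

Lemma edot_sqrD u v (t : R) : edot (u + t *: v) (u + t *: v) =
  edot u u + 2 * t * edot u v + t ^+ 2 * edot v v.
Proof. by rewrite edotDl !edotDr !edotZl !edotZr (edotC v u); ring. Qed.

Lemma edot_delta (i : 'I_d) u : edot (delta_mx 0 i) u = u 0 i.
Proof.
rewrite /edot (bigD1 i)//= mxE !eqxx mul1r big1 ?addr0// => j ji.
by rewrite mxE eqxx (negPf ji) mul0r.
Qed.

Lemma edot_ge0 u : 0 <= edot u u.
Proof. by apply: sumr_ge0 => j _; rewrite -expr2 sqr_ge0. Qed.

Lemma edot_eq0 u : edot u u = 0 -> u = 0.
Proof.
move=> /eqP; rewrite psumr_eq0 => [|j _]; last by rewrite -expr2 sqr_ge0.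
move=> /allP u0; apply/rowP => j; rewrite mxE.
by apply/eqP; have := u0 j (mem_index_enum j); rewrite mulf_eq0 orbb.
Qed.

Lemma sqr_enorm u : enorm u ^+ 2 = edot u u.
Proof. by rewrite sqr_sqrtr ?edot_ge0. Qed.

Lemma enorm_ge0 u : 0 <= enorm u.
Proof. exact: sqrtr_ge0. Qed.

Lemma enorm_eq0 u : enorm u = 0 -> u = 0.
Proof. by move=> u0; apply: edot_eq0; rewrite -sqr_enorm u0 expr0n. Qed.

Lemma enormZ k u : enorm (k *: u) = `|k| * enorm u.
Proof.
by rewrite /enorm edotZl edotZr mulrA -expr2 sqrtrM ?sqr_ge0// sqrtr_sqr.
Qed.

Lemma enormN u : enorm (- u) = enorm u.
Proof. by rewrite -scaleN1r enormZ normrN1 mul1r. Qed.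

Lemma enorm0 : enorm (0 : 'rV[R]_d) = 0.
Proof. by rewrite /enorm edot0l sqrtr0. Qed.

(** Expand the square of [enorm v *: u - enorm u *: v] and cancel the factor [enorm u * enorm v],
    which is positive once zero vectors are set apart. *)
Lemma cauchy_schwarz u v : edot u v <= enorm u * enorm v.
Proof.
have [u0|u0] := eqVneq (enorm u) 0.
  by rewrite (enorm_eq0 u0) edot0l enorm0 mul0r.
have [v0|v0] := eqVneq (enorm v) 0.
  by rewrite (enorm_eq0 v0) edotC edot0l enorm0 mulr0.
have uv0 : 0 < enorm u * enorm v by rewrite mulr_gt0// lt_def ?u0 ?v0 enorm_ge0.
have := edot_ge0 (enorm v *: u - enorm u *: v).
rewrite edotBl !edotBr !edotZl !edotZr (edotC v u) -!sqr_enorm => h.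
rewrite -(ler_pM2l uv0); nra.
Qed.

Lemma coord_le_enorm u (j : 'I_d) : `|u 0 j| <= enorm u.
Proof.
rewrite -(ler_pXn2r (n := 2)) ?nnegrE ?enorm_ge0//.
rewrite sqr_enorm real_normK ?num_real// /edot (bigD1 j)//= -expr2 lerDl.
by apply: sumr_ge0 => i _; rewrite -expr2 sqr_ge0.
Qed.

End Euclidean.

(** * Compactness and a minimax point for affine functions on a ball *)

Section Minimax.
Context {R : realType}.

Lemma continuous_sum {T : topologicalType} {n : nat} (F : 'I_n -> T -> R) :
  (forall i, continuous (F i)) -> continuous (fun x => \sum_(i < n) F i x).
Proof. by move=> cF; apply: continuous_big => //; exact: add_continuous. Qed.

Lemma continuous_edot {T : topologicalType} {n : nat} (u v : T -> 'rV[R]_n) :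
  (forall i, continuous (fun x => u x 0 i)) ->
  (forall i, continuous (fun x => v x 0 i)) ->
  continuous (fun x => edot (u x) (v x)).
Proof.
move=> cu cv; apply: continuous_sum => i x.
by apply: cvgM; [exact: cu|exact: cv].
Qed.

Lemma continuous_sqrt {T : topologicalType} (f : T -> R) :
  continuous f -> continuous (fun x => Num.sqrt (f x)).
Proof.
by move=> cf x; exact: (continuous_comp (cf x) (@sqrt_continuous _ (f x))).
Qed.

(** Closed inside a product of segments, because every coordinate is bounded by the Euclidean
    norm. *)
Lemma compact_eball {d : nat} (c : 'rV[R]_d) (D : R) : compact (eball c D).
Proof.
apply: (@subclosed_compact _ _
    [set v : 'rV[R]_d | forall i, `[c 0 i - D, c 0 i + D]%classic (v 0 i)]).
- have -> : eball c D = (fun x => enorm (x - c)) @^-1` [set r | r <= D] by [].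
  apply: preimage_closed; last exact: closed_le.
  have h i : continuous (fun y : 'rV[R]_d => (y - c) 0 i).
    under eq_fun do rewrite !mxE.
    by move=> y; exact: (cvgB (@coord_continuous R 1 d 0 i y) (cvg_cst _)).
  by move=> x _; apply: continuous_sqrt; exact: continuous_edot.
- by apply: (@rV_compact R d (fun i => `[c 0 i - D, c 0 i + D]%classic)) => i;
    exact: segment_compact.
- move=> x xD i /=; rewrite in_itv/= -ler_distl.
  by have := coord_le_enorm (x - c) i; rewrite !mxE => /le_trans; exact.
Qed.

Definition simplex (n : nat) : set 'rV[R]_n :=
  [set a | (forall i, 0 <= a 0 i) /\ \sum_i a 0 i = 1].

Lemma compact_simplex (n : nat) : compact (@simplex n).
Proof.
apply: (@subclosed_compact _ _
    [set v : 'rV[R]_n | forall i, `[0, 1]%classic (v 0 i)]).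
- have -> : @simplex n =
      (\bigcap_i ((fun a : 'rV[R]_n => a 0 i) @^-1` [set r | 0 <= r])) `&`
      (fun a : 'rV[R]_n => \sum_i a 0 i) @^-1` [set 1].
    by apply/seteqP; split => a [a0 a1]; split => // i; [move=> _|];
      exact: (a0 i).
  apply: closedI.
    apply: closed_bigI => i _; apply: preimage_closed; last exact: closed_ge.
    by move=> x _; exact: coord_continuous.
  apply: preimage_closed; last exact: closed_eq.
  by move=> x _; apply: continuous_sum => i; exact: coord_continuous.
- by apply: (@rV_compact R n (fun=> `[0, 1]%classic)) => i;
    exact: segment_compact.
- move=> a [a0 a1] i /=; rewrite in_itv/= a0 -a1 (bigD1 i)//= lerDl.
  exact: sumr_ge0.
Qed.

Lemma simplex_delta {n : nat} (i : 'I_n) : simplex (delta_mx 0 i).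
Proof.
split=> [j|]; first by rewrite mxE ler0n.
rewrite (bigD1 i)//= mxE !eqxx big1 ?addr0// => j ji.
by rewrite mxE eqxx (negPf ji).
Qed.

Lemma simplex_segment {n : nat} (a b : 'rV[R]_n) (t : R) :
  simplex a -> simplex b -> 0 <= t <= 1 -> simplex (a + t *: (b - a)).
Proof.
move=> [a0 a1] [b0 b1] /andP[t0 t1]; split=> [i|].
  by rewrite !mxE; have := a0 i; have := b0 i; nra.
under eq_bigr do rewrite !mxE.
by rewrite big_split/= -mulr_sumr sumrB a1 b1 subrr mulr0 addr0.
Qed.

(** Let t tend to 0. This extracts first-order conditions from inequalities with a higher-order
    remainder. *)
Lemma ler_of_perturbation (A B C : R) :
  (forall t, 0 < t <= 1 -> A <= B + t * C) -> A <= B.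
Proof.
move=> h; apply/ler_addgt0Pr => e e0.
have C0 : 0 < 1 + `|C| by rewrite ltr_pwDl.
pose t := Num.min 1 (e / (1 + `|C|)).
have t0 : 0 < t by rewrite lt_min ltr01 divr_gt0.
have t1 : t <= 1 by rewrite ge_min lexx.
have te : t * (1 + `|C|) <= e by rewrite -ler_pdivlMr// ge_min lexx orbT.
have := h t; rewrite t0 t1 => /(_ isT) /le_trans; apply; rewrite lerD2l.
by apply: le_trans te; rewrite ler_pM2l//; have := ler_norm C; lra.
Qed.

Section saddle.
Context {n d : nat}.
Variables (c : 'rV[R]_n.+1) (g : 'M[R]_(n.+1, d)) (D : R).
Hypothesis D0 : 0 <= D.

(** The dual function: the minimum over the ball of radius [D] about 0 of the affine functions
    [c 0 i + edot (row i g) y] combined with weights [a]. *)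
Let phi (a : 'rV[R]_n.+1) : R := edot a c - D * enorm (a *m g).

Let mul_coord_continuous (j : 'I_d) :
  continuous (fun a : 'rV[R]_n.+1 => (a *m g) 0 j).
Proof.
under eq_fun do rewrite mxE.
apply: continuous_sum => i x.
exact: (cvgM (@coord_continuous R 1 n.+1 0 i x) (cvg_cst _)).
Qed.

(** With [e = 0] this maximizes [phi] itself; a positive [e] gives the smoothed problem. *)
Let simplex_max (e : R) : exists2 a, simplex a &
  forall b, simplex b ->
    edot b c - D * Num.sqrt (edot (b *m g) (b *m g) + e) <=
    edot a c - D * Num.sqrt (edot (a *m g) (a *m g) + e).
Proof.
have [||a aS h] := @EVT_max_rV R n.+1 (fun b =>
   edot b c - D * Num.sqrt (edot (b *m g) (b *m g) + e)) _ _
   (@compact_simplex n.+1).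
- by exists (delta_mx 0 ord0); exact: simplex_delta.
- apply: continuous_subspaceT => a.
  have cdot : continuous (fun b : 'rV[R]_n.+1 => edot b c).
    apply: continuous_edot => i; first exact: coord_continuous.
    exact: cst_continuous.
  have cnorm :
      continuous (fun b : 'rV[R]_n.+1 => Num.sqrt (edot (b *m g) (b *m g) + e)).
    apply: continuous_sqrt => b.
    have cGG : continuous (fun b : 'rV[R]_n.+1 => edot (b *m g) (b *m g)).
      exact: continuous_edot.
    exact: (cvgD (cGG b) (cvg_cst _)).
  exact: (cvgB (cdot a) (cvgM (cvg_cst _) (cnorm a))).
- by exists a => [|b bS]; [exact: set_mem|apply: h; exact: mem_set].
Qed.

(* First-order optimality of a maximizer of phi with its norm smoothed to
   sqrt (|.|^2 + e^2), which is differentiable also where a *m g = 0. *)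
Let approx_saddle (e : R) : 0 < e -> exists a y,
  [/\ simplex a, enorm y <= D &
      forall i, c 0 i + edot (row i g) y <= phi a + D * e].
Proof.
move=> e0; have [a aS amax] := simplex_max (e ^+ 2).
set G := a *m g in amax *; set s := Num.sqrt _ in amax.
have sE : s ^+ 2 = edot G G + e ^+ 2.
  by rewrite sqr_sqrtr// addr_ge0 ?edot_ge0 ?sqr_ge0.
have s0 : 0 <= s by exact: sqrtr_ge0.
have GE := sqr_enorm G; have G0 := enorm_ge0 G; have GG0 := edot_ge0 G.
have es : e <= s by rewrite -(ler_pXn2r (n := 2)) ?nnegrE ?(ltW e0)// sE lerDr.
have Gs : enorm G <= s.
  by rewrite -(ler_pXn2r (n := 2)) ?nnegrE// sE GE lerDl sqr_ge0.
have s_gt0 : 0 < s by exact: lt_le_trans es.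
(* The point is minus the gradient of [D * sqrt (|G|^2 + e^2)] in [G]; it lies in the ball because
   [|G| <= s]. *)
exists a, (- (D / s) *: G); split=> //.
  rewrite enormZ normrN ger0_norm ?divr_ge0// mulrAC ler_pdivrMr//.
  exact: ler_wpM2l.
move=> i; rewrite edotZr /phi -/G.
set h := row i g - G.
(* Compare the maximizer with points of the segment towards the vertex [i] of the simplex, then let
   t tend to 0. *)
have opt : s * (c 0 i - edot a c) <= D * edot G h.
  apply: (@ler_of_perturbation _ _ (D * edot h h / 2)) => t /andP[t0 t1].
  have /amax : simplex (a + t *: (delta_mx 0 i - a)).
    by apply: simplex_segment => //; [exact: simplex_delta|rewrite ltW].
  rewrite (_ : (a + _) *m g = G + t *: h); last first.
    by rewrite mulmxDl -scalemxAl mulmxBl -rowE.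
  rewrite edotDl edotZl edotBl edot_delta.
  have : 0 <= edot (G + t *: h) (G + t *: h) + e ^+ 2.
    by rewrite addr_ge0 ?edot_ge0 ?sqr_ge0.
  move=> /sqr_sqrtr; set r := Num.sqrt _.
  rewrite edot_sqrD => rE opt.
  (* Bounds the increment of the square root by its tangent: [r - s <= (r^2 - s^2) / (2 s)]. *)
  have amgm : 2 * s * r <= s ^+ 2 + r ^+ 2.
    by have := sqr_ge0 (s - r); nra.
  rewrite -(ler_pM2l t0).
  have : 2 * (s * (r - s)) <= 2 * t * edot G h + t ^+ 2 * edot h h by nra.
  move=> /(ler_wpM2l D0) H1.
  have /(ler_wpM2l s0) H2 : t * (c 0 i - edot a c) <= D * (r - s) by lra.
  lra.
have -> : edot (row i g) G = edot G h + edot G G.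
  by rewrite edotBr (edotC G); ring.
apply: (@le_trans _ _ (edot a c - D / s * edot G G)).
  have -> : c 0 i = edot a c + (c 0 i - edot a c) by ring.
  have : c 0 i - edot a c <= D / s * edot G h.
    by rewrite mulrAC ler_pdivlMr// mulrC.
  nra.
(* The cost of smoothing: [|G|^2 / s = s - e^2 / s], where [s >= |G|] and [e <= s]. *)
have : edot G G / s >= enorm G - e.
  rewrite ler_pdivlMr// -GE; nra.
move=> /(ler_wpM2l D0); rewrite mulrA mulrAC; nra.
Qed.

(** The approximate saddle points bound the minimum over the ball of the largest affine function by
    [phi a + D * e] for every small [e]; compactness provides one [y] attaining that minimum. *)
Lemma saddle_point : exists a y,
  [/\ simplex a, enorm y <= D &
      forall i, c 0 i + edot (row i g) y <= edot a c - D * enorm (a *m g)].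
Proof.
have [a aS amax] := simplex_max 0.
have {}amax b : simplex b -> phi b <= phi a.
  by move=> /amax; rewrite !addr0.
(* Seeding the maximum with [phi a] is harmless, as [phi a] is the bound to be reached. *)
pose F y := \big[Num.max/phi a]_(i < n.+1) (c 0 i + edot (row i g) y).
have [||y yD ymin] := @EVT_min_rV R d F _ _ (@compact_eball d 0 D).
- by exists 0; rewrite /eball/= subr0 enorm0.
- apply: continuous_subspaceT; apply: continuous_big.
    exact: max_continuous.
  move=> i _ y.
  have cdot : continuous (edot (row i g)).
    apply: continuous_edot => j; last exact: coord_continuous.
    exact: cst_continuous.
  exact: (cvgD (cvg_cst _) (cdot y)).
exists a, y; split=> //; first by move: yD; rewrite inE /eball/= subr0.
move=> i; apply: (@le_trans _ _ (F y)); first exact: le_bigmax.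
(* The smoothing parameter [e] takes the role of t. *)
apply: (@ler_of_perturbation _ _ D) => e /andP[e0 _].
have [b [z [bS zD zb]]] := approx_saddle e0.
apply: le_trans (ymin z _) _; first by rewrite inE /eball/= subr0.
have De := mulr_ge0 D0 (ltW e0).
apply: bigmax_le => [|j _]; first by rewrite /phi; lra.
by apply: le_trans (zb j) _; rewrite mulrC lerD2r; exact: amax.
Qed.

End saddle.
End Minimax.

(** * Descent and convexity inequalities for smooth functions *)

Section Smooth.
Context {R : realType} {d : nat}.
Implicit Types (f : 'rV[R]_d -> R) (x y v : 'rV[R]_d) (L : R).

Lemma diff_gradient f x v : 'd f x v = edot (gradient f x) v.
Proof.
rewrite {1}[v]row_sum_delta linear_sum; apply: eq_bigr => j _.
by rewrite linearZ /= mxE mulrC.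
Qed.

Lemma is_derive_line f x v (t : R) : differentiable f (t *: v + x) ->
  is_derive t 1 (fun s : R => f (s *: v + x))
    (edot (gradient f (t *: v + x)) v).
Proof.
move=> df; rewrite -diff_gradient.
have dl : is_diff t (fun s : R => s *: v + x) (fun s => s *: v).
  by apply: is_diff_eq; exact: addr0.
have dfl : differentiable (f \o (fun s : R => s *: v + x)) t.
  exact: differentiable_comp.
apply: DeriveDef; first exact: diff_derivable.
by rewrite deriveE// diff_comp// diff_val/= scale1r.
Qed.

(** Mean value theorem on the segment from [x] to [x + v], after subtracting the linear and
    quadratic terms; the signs [k = 1] and [k = -1] give the two sides. *)
Lemma smooth_quadratic_bound L f x v : smooth L f ->
  `|f (x + v) - f x - edot (gradient f x) v| <= L / 2 * enorm v ^+ 2.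
Proof.
move=> [df lip].
suff h k : `|k| = 1 ->
    k * (f (x + v) - f x - edot (gradient f x) v) <= L / 2 * enorm v ^+ 2.
  have := h (-1); have := h 1; rewrite normr1 normrN1 ler_norml.
  by move=> /(_ erefl) h1 /(_ erefl) h2; apply/andP; split; lra.
move=> k1.
set p := edot (gradient f x) v; set q := L / 2 * enorm v ^+ 2.
pose F (s : R) := f (s *: v + x).
pose psi (t : R) := k * (F t - t * p) - t ^+ 2 * q.
have dpsi (t : R) :
    is_derive t 1 psi (k * (edot (gradient f (t *: v + x)) v - p) - 2 * t * q).
  have dF : is_derive t 1 F _ := is_derive_line (df (t *: v + x)).
  have -> : psi = cst k * (F - id * cst p) - id ^+ 2 * cst q by [].
  apply: is_derive_eq.
  by rewrite /cst/= !scaler0 add0r addr0 add0r /GRing.scale/=; ring.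
have cpsi : {within `[0, 1], continuous psi}.
  apply: continuous_subspaceT => t; apply: differentiable_continuous.
  exact/derivable1_diffP.
have [c] := MVT ltr01 (fun t _ => dpsi t) cpsi.
rewrite in_itv/= => /andP[c0 c1].
have -> : psi 1 - psi 0 = k * (f (x + v) - f x - p) - q.
  by rewrite /psi /F scale1r scale0r add0r (addrC v); ring.
rewrite subr0 mulr1 => psi01; rewrite -subr_le0 psi01 subr_le0.
(* The intermediate point is at distance [c * enorm v] from [x], so this is the Lipschitz bound on
   the gradient change, times [enorm v]. *)
have -> : 2 * c * q = L * enorm (c *: v + x - x) * enorm v.
  by rewrite addrK enormZ (gtr0_norm c0) /q; field.
rewrite -edotBl.
have CS := cauchy_schwarz (k *: (gradient f (c *: v + x) - gradient f x)) v.
move: CS; rewrite edotZl enormZ k1 mul1r => /le_trans; apply.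
by rewrite ler_wpM2r ?enorm_ge0.
Qed.

Lemma smooth_upper_bound L f x v : smooth L f ->
  f (x + v) <= f x + edot (gradient f x) v + L / 2 * enorm v ^+ 2.
Proof.
by move=> /(smooth_quadratic_bound x v); rewrite ler_norml => /andP[]; lra.
Qed.

(** Convexity at a point [x + t (y - x)], divided by t; the quadratic bound controls the remainder
    as t tends to 0. *)
Lemma convex_gradient_bound L f x y : smooth_convex L f ->
  f x + edot (gradient f x) (y - x) <= f y.
Proof.
move=> [sf cf]; rewrite -lerBrDl.
apply: (@ler_of_perturbation _ _ _ (L / 2 * enorm (y - x) ^+ 2)).
move=> t /andP[t0 t1].
have cfxy : f (t *: y + (1 - t) *: x) <= t * f y + (1 - t) * f x :=
  cf (Itv01 (ltW t0) t1) y x (in_setT _) (in_setT _).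
have xyE : t *: y + (1 - t) *: x = x + t *: (y - x).
  by apply/rowP => j; rewrite !mxE; ring.
have := smooth_quadratic_bound x (t *: (y - x)) sf.
rewrite -xyE edotZr enormZ (gtr0_norm t0) exprMn ler_norml => /andP[lb _].
rewrite -(ler_pM2l t0); lra.
Qed.

(** A step of [- L^-1] times the gradient would lower [f] if the gradient were nonzero. *)
Lemma gradient_minimizer L f x : 0 < L -> smooth L f -> minimizer f x ->
  gradient f x = 0.
Proof.
move=> L0 sf fmin; apply: edot_eq0; apply/eqP; rewrite eq_le edot_ge0 andbT.
have := le_trans (fmin _) (smooth_upper_bound x (- L^-1 *: gradient f x) sf).
rewrite edotZr sqr_enorm edotZl edotZr.
set e := edot _ _.
have -> : L / 2 * (- L^-1 * (- L^-1 * e)) = e / L / 2 by field; rewrite gt_eqF.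
rewrite mulNr (mulrC _ e) => h.
have : e / L <= 0 by lra.
by rewrite ler_pdivrMr// mul0r.
Qed.

(** One gradient step from [x] already decreases [f] by the stated amount, and the minimum lies
    below the value reached. *)
Lemma smooth_minimizer_le L f x xs : 0 < L -> smooth L f -> minimizer f xs ->
  f xs <= f x - 1 / (2 * L) * enorm (gradient f x) ^+ 2.
Proof.
move=> L0 sf fmin.
apply: le_trans (fmin (x + - L^-1 *: gradient f x)) _.
apply: le_trans (smooth_upper_bound _ _ sf) _.
rewrite edotZr !sqr_enorm edotZl edotZr le_eqVlt; apply/orP; left; apply/eqP.
by field; rewrite gt_eqF.
Qed.

(* The convexity inequality between x and xs + (gradient f x) / L, with the
   descent inequality from xs where the gradient vanishes. *)
Lemma smooth_convex_minimizer_ge L f x xs : 0 < L -> smooth_convex L f ->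
  minimizer f xs ->
  f x + 1 / (2 * L) * enorm (gradient f x) ^+ 2 +
    edot (gradient f x) (xs - x) <= f xs.
Proof.
move=> L0 [sf cf] fmin; set g := gradient f x.
have h1 := convex_gradient_bound x (xs + L^-1 *: g) (conj sf cf).
have h2 := smooth_upper_bound xs (L^-1 *: g) sf.
move: h1 h2; rewrite (gradient_minimizer L0 sf fmin) edot0l addr0.
rewrite -/g !sqr_enorm edotBr edotDr !edotZr edotZl edotBr.
have -> : L / 2 * (L^-1 * (L^-1 * edot g g)) = L^-1 * edot g g / 2.
  by field; rewrite gt_eqF.
have -> : 1 / (2 * L) * edot g g = L^-1 * edot g g / 2.
  by field; rewrite gt_eqF.
lra.
Qed.

Lemma gradient_affine (u : 'rV[R]_d) (b : R) x :
  gradient (fun y => edot u y + b) x = u.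
Proof.
have lin : linear (edot u) by move=> k v w; rewrite edotDr edotZr.
pose linM := GRing.isLinear.Build _ _ _ _ _ lin.
pose ul : {linear 'rV[R]_d -> R} := HB.pack (edot u) linM.
have cul : continuous ul.
  apply: continuous_edot => j; first exact: cst_continuous.
  exact: coord_continuous.
apply/rowP => j; rewrite mxE.
have -> : (fun y => edot u y + b) = (ul : _ -> _) + cst b by [].
rewrite diffD//; last exact: linear_differentiable.
rewrite diff_lin// diff_cst -[LHS]/(edot u (delta_mx 0 j) + 0).
by rewrite addr0 edotC edot_delta.
Qed.
End Smooth.

(** * Aggregated cuts and the square correction *)

Section Certificate.
Context {R : realType} {d : nat}.

Lemma edot_mulmxl (n : nat) (a : 'rV[R]_n) (G : 'M[R]_(n, d)) (v : 'rV[R]_d) :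
  edot (a *m G) v = \sum_i a 0 i * edot (row i G) v.
Proof.
rewrite /edot; under eq_bigr do rewrite mxE mulr_suml.
rewrite exchange_big; apply: eq_bigr => i _; rewrite mulr_sumr.
by apply: eq_bigr => j _; rewrite mxE mulrA.
Qed.

Lemma edot_ball_ge (u v : 'rV[R]_d) (D : R) : enorm v <= D ->
  - (D * enorm u) <= edot u v.
Proof.
move=> vD; have := cauchy_schwarz u (- v); rewrite edotNr enormN.
by have := ler_wpM2r (enorm_ge0 u) vD; lra.
Qed.

Context {N : nat}.
Variables (L : R) (x : 'I_N.+1 -> 'rV[R]_d) (fv : 'I_N.+1 -> R)
  (g : 'I_N.+1 -> 'rV[R]_d).

Definition lower_cut (i : 'I_N.+1) (y : 'rV[R]_d) : R :=
  fv i + 1 / (2 * L) * enorm (g i) ^+ 2 + edot (g i) (y - x i).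

(** Recentres the cuts at [x ord0], so that the ball becomes one about 0, the setting of
    [saddle_point]. *)
Lemma aggregateE (a : 'rV[R]_N.+1) (y : 'rV[R]_d) :
  aggregate L x fv g (a 0) y =
  edot a (\row_i lower_cut i (x ord0)) + edot (a *m \matrix_i g i) (y - x ord0).
Proof.
rewrite edot_mulmxl -big_split; apply: eq_bigr => i _ /=.
by rewrite !mxE rowK /lower_cut !edotBr; ring.
Qed.

Lemma gradient_aggregate (a : 'rV[R]_N.+1) (y : 'rV[R]_d) :
  gradient (aggregate L x fv g (a 0)) y = a *m \matrix_i g i.
Proof.
rewrite -[RHS](gradient_affine _ (edot a (\row_i lower_cut i (x ord0)) -
  edot (a *m \matrix_i g i) (x ord0)) y); congr gradient; apply/funext => z.
by rewrite aggregateE edotBr; ring.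
Qed.

(** Serves with [m] equal to [mn], to [f xs] and to a feasible [fs] in turn. *)
Lemma aggregate_le (a : 'I_N.+1 -> R) (y : 'rV[R]_d) (m : R) :
  (forall i, 0 <= a i) -> \sum_i a i = 1 -> (forall i, lower_cut i y <= m) ->
  aggregate L x fv g a y <= m.
Proof.
move=> a0 a1 ym; rewrite -[leRHS]mul1r -a1 mulr_suml.
by apply: ler_sum => i _; exact: (ler_wpM2l (a0 i) (ym i)).
Qed.

(* Completing the square: sigma |z - u|^2 absorbs the linear term of alpha up to
   D |G|, the decrease of alpha from the centre to its minimum over the ball. *)
Lemma sqr_correction_le (D sigma : R) (G u z : 'rV[R]_d) : 0 < D ->
  enorm u <= D ->
  (G <> 0 -> sigma = enorm G / (2 * D) /\ z = - (1 / (2 * sigma)) *: G) ->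
  (G = 0 -> sigma = 0) ->
  0 <= sigma /\ sigma * enorm (z - u) ^+ 2 <= edot G u + D * enorm G.
Proof.
move=> D0 uD hG hG0; have [G0|/eqP GN0] := eqVneq G 0.
  by rewrite (hG0 G0) G0 mul0r edot0l enorm0 mulr0 addr0.
have [-> ->] := hG GN0.
have nG : 0 < enorm G.
  by rewrite lt_def enorm_ge0 andbT; apply/eqP => /enorm_eq0.
split; first by rewrite divr_ge0 ?enorm_ge0// mulr_ge0// ltW.
have -> : - (1 / (2 * (enorm G / (2 * D)))) = - (D / enorm G).
  by field; rewrite !gt_eqF.
(* Here [z = - k G] has norm [D]: it is the minimizer of the linear form [edot G] over the ball. *)
set k := D / enorm G.
have kG : k * enorm G = D by rewrite /k divfK ?gt_eqF.
rewrite sqr_enorm edotBl !edotBr !edotZl !edotZr -!sqr_enorm (edotC u).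
have -> : - k * (- k * enorm G ^+ 2) = D ^+ 2 by rewrite -kG; ring.
rewrite mulrAC ler_pdivrMr ?mulr_gt0//.
have uD2 : enorm u ^+ 2 <= D ^+ 2.
  by rewrite ler_pXn2r// nnegrE ?enorm_ge0// ltW.
have -> :
    enorm G * (D ^+ 2 - - k * edot G u - (- k * edot G u - enorm u ^+ 2)) =
    enorm G * D ^+ 2 + 2 * (k * enorm G) * edot G u + enorm G * enorm u ^+ 2.
  by ring.
rewrite kG; have := ler_wpM2l (ltW nG) uD2; lra.
Qed.

End Certificate.

(* rstar and mn are the attained maximum and minimum of the text; their
   existence is part of the conclusion.  The gradient of alpha is constant
   and is taken at x ord0. *)
Theorem theorem4p2 (R : realType) (d N : nat) (L D : R)
    (x : 'I_N.+1 -> 'rV[R]_d) (fv : 'I_N.+1 -> R) (g : 'I_N.+1 -> 'rV[R]_d)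
    (hL : 0 < L) (hD : 0 < D)
    (hcons : exists f xs, smooth_convex L f /\ consistent x fv g f /\
       minimizer f xs /\ enorm (x ord0 - xs) <= D) :
  exists rstar, is_maximum (certificate_gaps L D x fv g) rstar /\
  exists a : 'I_N.+1 -> R,
    (forall i, 0 <= a i) /\ \sum_(i < N.+1) a i = 1 /\
    let alpha := aggregate L x fv g a in
    let galpha := gradient alpha (x ord0) in
    exists mn, is_minimum (alpha @` eball (x ord0) D) mn /\
    forall (f : 'rV[R]_d -> R) (xs : 'rV[R]_d),
      smooth_convex L f -> consistent x fv g f ->
      minimizer f xs -> enorm (x ord0 - xs) <= D ->
      affine_minorants f xs alpha /\
      forall (sigma : R) (z : 'rV[R]_d),
        (galpha <> 0 -> sigma = enorm galpha / (2 * D) /\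
                        z = x ord0 - (1 / (2 * sigma)) *: galpha) ->
        (galpha = 0 -> sigma = 0) ->
        [/\ fv ord_max - f xs
              <= fv ord_max - f xs + sigma * enorm (z - xs) ^+ 2,
            fv ord_max - f xs + sigma * enorm (z - xs) ^+ 2
              <= fv ord_max - alpha xs + sigma * enorm (z - xs) ^+ 2,
            fv ord_max - alpha xs + sigma * enorm (z - xs) ^+ 2
              <= fv ord_max - mn
          & fv ord_max - mn <= rstar].
Proof.
pose c := \row_i lower_cut L x fv g i (x ord0); pose G := \matrix_i g i.
have [a [y [[a0 a1] yD ay]]] := saddle_point c G (ltW hD).
pose mn := edot a c - D * enorm (a *m G).
have alphaE := aggregateE L x fv g a; rewrite -/c -/G in alphaE.
set alpha := aggregate L x fv g (a 0) in alphaE.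
have xyE : x ord0 + y - x ord0 = y by rewrite addrC addKr.
have lower_cut_mn i : lower_cut L x fv g i (x ord0 + y) <= mn.
  apply: le_trans (ay i); rewrite /c /G mxE rowK /lower_cut.
  by rewrite !edotBr edotDr; lra.
have mn_alpha z : enorm (z - x ord0) <= D -> mn <= alpha z.
  by move=> /(edot_ball_ge (a *m G)); rewrite alphaE /mn; lra.
have alpha_minimizer (f : 'rV[R]_d -> R) xs : smooth_convex L f ->
    consistent x fv g f -> minimizer f xs -> alpha xs <= f xs.
  move=> scf cons fmin; apply: aggregate_le => // i.
  have [fi gi] := cons i.
  by have := smooth_convex_minimizer_ge (x i) hL scf fmin; rewrite fi gi.
have mn_max : is_maximum (certificate_gaps L D x fv g) (fv ord_max - mn).
  split.
    exists (x ord0 + y), mn; split=> //; split.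
      rewrite subr_ge0 opprD addNKr enormN.
      by rewrite ler_pXn2r ?nnegrE ?enorm_ge0 ?(ltW hD).
    move=> i; split; first by have := lower_cut_mn i; rewrite /lower_cut; lra.
    (* The chain is [mn <= alpha xs <= f xs <= fv i - |g_i|^2 / (2 L)]. *)
    have [f [xs [scf [cons [fmin xsD]]]]] := hcons.
    have := smooth_minimizer_le (x i) hL (proj1 scf) fmin.
    have [-> ->] := cons i.
    have := alpha_minimizer f xs scf cons fmin.
    have := mn_alpha xs; rewrite -enormN opprB => /(_ xsD); lra.
  (* Conversely, feasibility puts every cut at [xs] below [fs], whence [mn <= alpha xs <= fs]. *)
  move=> _ [xs [fs [[xsD feas] ->]]].
  rewrite lerD2l lerN2; apply: le_trans (mn_alpha xs _) _.
    rewrite -enormN opprB -(ler_pXn2r (n := 2)) ?nnegrE ?enorm_ge0 ?(ltW hD)//.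
    by rewrite -subr_ge0.
  apply: aggregate_le => // i; have [+ _] := feas i; rewrite /lower_cut; lra.
exists (fv ord_max - mn); split=> //; exists (a 0); split=> //; split=> //.
rewrite /= -/alpha; exists mn; split.
  split; last by move=> _ [z zD <-]; exact: mn_alpha.
  exists (x ord0 + y); first by rewrite /eball/= xyE.
  (* At the saddle point every cut is at most [mn], so [alpha] is too; the ball bound gives the
     reverse. *)
  apply: le_anti; rewrite aggregate_le//= mn_alpha//.
  by rewrite xyE.
rewrite gradient_aggregate -/G => f xs scf cons fmin xsD.
have alpha_le := alpha_minimizer f xs scf cons fmin.
split.
  split=> //; exists (a *m G), (edot a c - edot (a *m G) (x ord0)) => z.
  by rewrite alphaE edotBr; ring.
move=> sigma z hz hz0.
(* Displacements are measured from [x ord0]; the resulting bound is [alpha xs - mn], which yields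
   the third inequality. *)
have [||sigma0 corr] := @sqr_correction_le _ _ D sigma (a *m G) (xs - x ord0)
  (z - x ord0) hD _ _ hz0.
- by rewrite -enormN opprB.
- by move=> /hz[-> ->]; split=> //; rewrite addrAC subrr add0r scaleNr.
have zxE : z - x ord0 - (xs - x ord0) = z - xs.
  by apply/rowP => j; rewrite !mxE; ring.
rewrite zxE in corr.
have := mulr_ge0 sigma0 (sqr_ge0 (enorm (z - xs))).
by move: corr; rewrite alphaE /mn; rewrite alphaE in alpha_le; split; lra.
Qed.
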